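(* Let $R$ be a finite commutative ring with identity $1 \neq 0$, and suppose $|R| = l$. Then $$P(R) \leq \frac{2l + (m-1)|Z(R)| - 1}{l^2},$$ where $Z(R)$ is the set of nonzero zero-divisors of $R$ and $m = \max\{|Ann(x)| : x \in Z(R)\}$ (if $Z(R)$ is empty, the term $(m-1)|Z(R)|$ is read as $0$).
   Context: For a finite ring $R$, $P(R)$ denotes the probability that two elements of $R$ chosen at random (with replacement) have product zero, i.e. $P(R) = \frac{|Ann|}{|R\times R|}$, where $Ann = \{(x,y) \in R\times R : xy = 0\}$. For $x \in R$, $Ann(x) = \{y \in R : xy = 0\}$ is the annihilator of $x$ in $R$. $Z(R)$ denotes the set of nonzero zero-divisors of $R$, i.e. the nonzero $x \in R$ for which there exists a nonzero $y\in R$ with $xy=0$; in particular $0 \notin Z(R)$. *)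

(* Defs.v *)
From HB Require Import structures.
From mathcomp Require Import all_boot all_order all_algebra.

Set Implicit Arguments.
Unset Strict Implicit.
Unset Printing Implicit Defensive.

Import Order.TTheory GRing.Theory Num.Theory.

Local Open Scope ring_scope.

Definition annpairs (R : finPzRingType) : {set R * R} :=
  [set p : R * R | p.1 * p.2 == 0].

Definition zeroprob (R : finPzRingType) : rat :=
  #|annpairs R|%:R / #|{: R * R}|%:R.

Definition annihilator (R : finPzRingType) (x : R) : {set R} :=
  [set y : R | x * y == 0].

Definition zerodivisors (R : finPzRingType) : {set R} :=
  [set x : R | (x != 0) && [exists y : R, (y != 0) && (x * y == 0)]].

(* By the convention on empty maxima this is 0 when R has no nonzero
   zero-divisors. *)
Definition maxann (R : finPzRingType) : nat :=
  \max_(x in zerodivisors R) #|annihilator x|.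

(* Main.v *)
Require Import Defs.
From HB Require Import structures.
From mathcomp Require Import all_boot all_order all_algebra.
From mathcomp Require Import ring.

Import Order.TTheory GRing.Theory Num.Theory.
Local Open Scope ring_scope.

(** Count the pairs with product zero by first coordinate ([card_annpairs]). The fibre over 0 has at
    most l elements, the fibre over a zero-divisor at most m, and each of the l - 1 - |Z(R)| other
    fibres only the element 0. The total is at most l + m|Z(R)| + (l - 1 - |Z(R)|); divide by l^2.
    [card_annihilator_le] merges the three cases into one inequality, which [card_annpairs_le] sums
    over x. *)

Lemma card_annpairs (R : finPzRingType) :
  #|annpairs R| = (\sum_(x : R) #|annihilator x|)%N.
Proof.
rewrite -sum1_card (eq_bigr (fun x => \sum_(y in annihilator x) 1)%N).
  rewrite pair_big_dep /=.
  by apply: eq_bigl => -[x y]; rewrite !inE.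
by move=> x _; rewrite sum1_card.
Qed.

Lemma card_annihilator_regular (R : finPzRingType) (x : R) :
  x != 0 -> x \notin zerodivisors R -> #|annihilator x| = 1%N.
Proof.
move=> x0; rewrite inE x0 /= negb_exists => /forallP xreg.
rewrite -(cards1 (0 : R)); congr #|pred_of_set _|; apply/setP => y.
rewrite !inE; have := xreg y; rewrite negb_and negbK.
by case: eqP => [-> _|_ /negbTE //]; rewrite mulr0 eqxx.
Qed.

(* The indicators sit on both sides so that no truncated subtraction occurs. *)
Lemma card_annihilator_le (R : finPzRingType) (x : R) :
  (#|annihilator x| + (x \in zerodivisors R) + (x == 0%R) <=
     1 + (x \in zerodivisors R) * maxann R + (x == 0%R) * #|R|)%N.
Proof.
have [->|x0] := eqVneq x 0.
  (* 0 is not in [zerodivisors R], so only the trivial bound by [#|R|] remains. *)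
  by rewrite inE eqxx /= mul1n !addn0 addnC leq_add2l max_card.
have [xZ|xZ] := boolP (x \in zerodivisors R); last first.
  by rewrite card_annihilator_regular.
rewrite mul1n !addn0 addnC leq_add2l.
exact: (leq_bigmax_cond (F := fun z => #|annihilator z|)).
Qed.

Lemma card_annpairs_le (R : finPzRingType) :
  (#|annpairs R| + #|zerodivisors R| + 1 <=
     2 * #|R| + #|zerodivisors R| * maxann R)%N.
Proof.
have sum0 : (\sum_(x : R) (x == 0%R) = 1)%N.
  by rewrite (bigD1 0) //= eqxx big1 // => x /negbTE ->.
have sumZ : (\sum_(x : R) (x \in zerodivisors R) = #|zerodivisors R|)%N.
  by rewrite -big_mkcond sum1_card.
(* Summed over x, the indicators become 1 and [#|zerodivisors R|]. *)
have := @leq_sum _ (index_enum R) xpredT _ _ (fun x _ => card_annihilator_le R x).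
rewrite !big_split /= -!big_distrl /= sum0 sumZ -card_annpairs sum1_card mul1n.
by rewrite mul2n -addnn (addnAC #|R| #|R|).
Qed.

Theorem theorem2p2 (R : finComNzRingType) (l : nat) (hl : #|R| = l) :
  zeroprob R <=
    (2 * l%:R + ((maxann R)%:R - 1) * #|zerodivisors R|%:R - 1) / l%:R ^+ 2.
Proof.
rewrite /zeroprob card_prod hl natrM -expr2.
apply: ler_wpM2r; first by rewrite invr_ge0 exprn_ge0.
(* Subtraction is exact in [rat]: if Z(R) is empty, [maxann R] is 0 and the factor -1 is multiplied
   by 0. *)
have := card_annpairs_le R; rewrite hl -(ler_nat rat) !natrD !natrM.
rewrite -lerBrDr -lerBrDr => /le_trans; apply.
by rewrite le_eqVlt; apply/orP; left; apply/eqP; ring.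
Qed.
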